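(* For any self-seeding, single-tile, translation-only (non-rotatable, non-flippable) self-assembly system $\Gamma=(T,\tau)$, the set of producible assemblies of $\Gamma$ is either just the single seed copy of the tile, or contains assemblies of unbounded size.
   Context: A tile is a bounded, connected, regular closed set $P\subset\mathbb{R}^2$ (equal to the closure of its interior), with glues (of given strengths in $\mathbb{N}$) assigned to parts of its boundary. Two placed copies overlap if their interiors intersect, and touch if they intersect without overlapping. Two touching copies can bond with the strength of a glue if they touch in more than one point along boundary portions carrying the same glue. A single-tile translation-only system $\Gamma=(T,\tau)$ with $T=\{P\}$ and temperature $\tau$ uses only translated copies of $P$ (no rotation or reflection). Self-seeding: assembly starts from a single copy of $P$, and a translated copy may be added to the current assembly if it overlaps no tile of the assembly and the total strength of its bonds with the assembly is at least $\tau$. Producible assemblies are those reachable in this way.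
   Formalization: The tile's interior is required to be connected, not only the tile itself: for tiles with pinch points the claim fails (e.g. three unit squares joined at corners, whose largest assembly has exactly two copies). *)

(* Defs.v *)
From HB Require Import structures.
From mathcomp Require Import all_boot all_order all_algebra finmap.
From mathcomp Require Import all_classical all_reals all_analysis.

Set Implicit Arguments.
Unset Strict Implicit.
Unset Printing Implicit Defensive.

Import Order.TTheory GRing.Theory Num.Theory.
Import numFieldNormedType.Exports.

Local Open Scope classical_set_scope.
Local Open Scope ring_scope.

Notation plane R := (R * R)%type.

Definition boundary (T : topologicalType) (A : set T) : set T :=
  closure A `\` A°.

(* A glued part of the boundary is a member of the family [portion]; it carries
   the glue [label i], and distinct portions may carry the same glue.  Neither
   the set of glues nor the set of portions is assumed finite.

   Connectedness is required of the interior, which for a regular closed set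
   implies connectedness of the set itself (lemma [shape_connected]).  The
   latter alone would allow pinch points, at which a tile and its translate can
   cross without overlapping: the union S of the unit squares
   [0,1]x[0,1], [1,2]x[-1,0], [2,3]x[0,1] meets S + (1,0) without overlapping
   it but overlaps S + (2,0), so with one glue of strength 1 on {0}x[0,1] and
   {1}x[0,1] and temperature 1 the largest assembly has exactly two tiles. *)
Record tile (R : realType) := Tile {
  shape : set (plane R) ;
  glue : choiceType ;
  strength : glue -> nat ;
  portion_index : choiceType ;
  portion : portion_index -> set (plane R) ;
  label : portion_index -> glue ;
  shape_bounded : bounded_set shape ;
  shape_regular : closure shape° = shape ;
  shape_interior_connected : connected shape° ;
  portion_boundary : forall i, portion i `<=` boundary shape
}.

Lemma shape_connected (R : realType) (P : tile R) : connected (shape P).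
Proof.
rewrite -(shape_regular P).
exact/connected_closure/shape_interior_connected.
Qed.

Definition translate (R : realType) (v : plane R) (A : set (plane R)) :
  set (plane R) := [set v + x | x in A].

Definition copy (R : realType) (P : tile R) (v : plane R) : set (plane R) :=
  translate v (shape P).

Definition overlap (T : topologicalType) (A B : set T) : Prop :=
  A° `&` B° !=set0.

Definition touch (T : topologicalType) (A B : set T) : Prop :=
  A `&` B !=set0 /\ ~ overlap A B.

Definition more_than_one_point (T : Type) (A : set T) : Prop :=
  exists x y, [/\ A x, A y & x <> y].

(* The bonds between the copies of P at u and at v: pairs of a portion of the
   first copy and a portion of the second one. *)
Definition bonds (R : realType) (P : tile R) (u v : plane R) :
  set (portion_index P * portion_index P) :=
  [set ij | [/\ touch (copy P u) (copy P v),
                label ij.1 = label ij.2 &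
                more_than_one_point (translate u (portion ij.1) `&`
                                     translate v (portion ij.2))]].

Arguments bonds {R} P u v _.

(* Extended-real valued because there may be infinitely many bonds. *)
Definition bond_strength (R : realType) (P : tile R) (u v : plane R) : \bar R :=
  (\esum_(ij in bonds P u v) ((strength (label ij.1))%:R)%:E)%E.

(* An assembly is the finite set of the positions of its copies of P; the seed
   is placed at the origin. *)
Inductive producible (R : realType) (P : tile R) (tau : nat) :
    {fset plane R} -> Prop :=
| producible_seed : producible P tau [fset (0 : plane R)]%fset
| producible_add (A : {fset plane R}) (v : plane R) :
    producible P tau A ->
    (forall u, u \in A -> ~ overlap (copy P u) (copy P v)) ->
    ((tau%:R)%:E <= \sum_(u <- enum_fset A) bond_strength P u v)%E ->
    producible P tau (v |` A)%fset.

(* Main.v *)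
Require Import Defs.
From HB Require Import structures.
From mathcomp Require Import all_boot all_order all_algebra finmap.
From mathcomp Require Import all_classical all_reals all_analysis.
From mathcomp Require Import zify ring lra.

Set Implicit Arguments.
Unset Strict Implicit.
Unset Printing Implicit Defensive.

Import Order.TTheory GRing.Theory Num.Theory.
Import numFieldNormedType.Exports.

Local Open Scope classical_set_scope.
Local Open Scope ring_scope.

(* If the copy at v <> 0 can be attached to the seed, then the copies at
   0, v, 2v, ... can be attached one after the other, each bonding with its
   predecessor as v bonds with the seed, provided that they do not overlap.
   Hence the heart of the matter is the following planar fact, in the spirit of
   Hopf's theorem on chords of continua: a connected open set U disjoint from
   U + v is disjoint from all the U + nv.  By induction on n, it is enough to
   show that if U is disjoint from U + a and from U + b, where a and b are
   positive multiples of v, then it is disjoint from U + (a + b).  Otherwise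
   there is a path K in U from some x to x + a + b, and it may be taken on a
   fine square lattice.  The paths K - b and K + a meet at x + a, so their union
   joins t - b to t + a, where t is a highest point of K (v being horizontal).
   It therefore has to cross the part of K that joins t to a lowest point of K,
   because it stays within the same horizontal strip; but K is disjoint from
   both K - b and K + a. *)

(** * Lattice walks and the parity of crossings *)

Definition neighbor (z z' : int * int) : bool :=
  (`|z.1 - z'.1| + `|z.2 - z'.2| <= 1)%R.

(* Whether z and z' are the endpoints, in either order, of the vertical edge
   from (x', y) to (x', y + 1) for some x' < x, given that they are neighbors. *)
Definition edge_left (z z' : int * int) (x y : int) : bool :=
  (z.1 < x) && ((z.2 == y) && (z'.2 == y + 1) || (z.2 == y + 1) && (z'.2 == y)).

Lemma neighborP a b c d : neighbor (a, b) (c, d) ->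
  c = a /\ (d = b \/ d = b + 1 \/ b = d + 1) \/
  d = b /\ (c = a + 1 \/ a = c + 1).
Proof. by rewrite /neighbor /= => h; lia. Qed.

(** Moving the ray one step to the right adds only the edge just above [(x, y)], which has [(x, y)]
    as an endpoint. *)
Lemma edge_left_horizontal z z' x y : neighbor z z' ->
  z != (x, y) -> z' != (x, y) -> edge_left z z' (x + 1) y = edge_left z z' x y.
Proof.
case: z z' => [a b] [c d] /neighborP; rewrite /edge_left !xpair_eqE /=.
move=> h n n'; have e : (a < x + 1) = (a < x) || (a == x) by lia.
rewrite e; case: (eqVneq a x) n => [ax|_]; last by rewrite orbF.
rewrite orbT ax ltxx /= => n; apply/negP => k.
case/orP: k => /andP[/eqP kb /eqP kd]; lia.
Qed.

(** A step with exactly one end at height [y + 1] is vertical and lies in exactly one of the two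
    rows; a step along that height lies in neither, and both its ends are on the same side of
    [(x, y + 1)]. *)
Lemma edge_left_vertical z z' x y : neighbor z z' ->
  z != (x, y + 1) -> z' != (x, y + 1) ->
  edge_left z z' x (y + 1) (+) edge_left z z' x y =
  ((z.1 < x) && (z.2 == y + 1)) (+) ((z'.1 < x) && (z'.2 == y + 1)).
Proof.
case: z z' => [a b] [c d] /neighborP; rewrite /edge_left !xpair_eqE /=.
have n1 : ((y == y + 1) = false) * ((y + 1 == y) = false) by split; lia.
have n2 : ((y == y + 1 + 1) = false) * ((y + 1 + 1 == y) = false).
  by split; lia.
have n3 : ((y + 1 == y + 1 + 1) = false) * ((y + 1 + 1 == y + 1) = false).
  by split; lia.
pose E := (n1, n2, n3, @eqxx int).
move=> h n n'.
have [hb|hb] := eqVneq b (y + 1); have [hd|hd] := eqVneq d (y + 1); subst.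
- rewrite !E ?andbF /= !andbT in n n' *.
  by have ->: (c < x) = (a < x); [lia | rewrite addbb].
- have ac : c = a by lia.
  have hy : d = y \/ d = y + 1 + 1 by lia.
  by rewrite ac; case: hy => ->; rewrite !E ?andbF ?andbT ?addbF ?addFb.
- have ac : c = a by lia.
  have hy : b = y \/ b = y + 1 + 1 by lia.
  by rewrite ac; case: hy => ->; rewrite !E ?andbF ?andbT ?addbF ?addFb.
- by rewrite ?andbF.
Qed.

Lemma addb_telescope (h : nat -> bool) lo hi : (lo <= hi)%N ->
  \big[addb/false]_(lo <= i < hi) (h i (+) h i.+1) = h lo (+) h hi.
Proof.
move=> /subnKC <-; elim: (hi - lo)%N => [|k IH].
  by rewrite addn0 big_geq // addbb.
by rewrite addnS big_nat_recr ?leq_addr //= IH addbA addbK.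
Qed.

Definition walk (K : nat -> int * int) (L : nat) : Prop :=
  forall i, (i < L)%N -> neighbor (K i) (K i.+1).

Lemma no_chord_sum (K : nat -> int * int) L (a b : int) : 0 < a -> 0 < b ->
  walk K L -> K L = K 0%N + (a + b, 0) ->
  (forall i j, (i <= L)%N -> (j <= L)%N -> K i != K j + (a, 0)) ->
  (forall i j, (i <= L)%N -> (j <= L)%N -> K i != K j + (b, 0)) -> False.
Proof.
move=> a0 b0 wK KL na nb.
have [t _ tmax] := @Order.TotalTheory.arg_maxP _ _ 'I_L.+1 ord0 predT
  (fun i => (K i).2) isT.
have [s _ smin] := @Order.TotalTheory.arg_minP _ _ 'I_L.+1 ord0 predT
  (fun i => (K i).2) isT.
have {}tmax i : (i <= L)%N -> (K i).2 <= (K t).2.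
  by rewrite -ltnS => iL; apply: (tmax (Ordinal iL)).
have {}smin i : (i <= L)%N -> (K s).2 <= (K i).2.
  by rewrite -ltnS => iL; apply: (smin (Ordinal iL)).
pose lo := minn s t; pose hi := maxn s t.
have lohi : (lo <= hi)%N by rewrite /lo /hi; lia.
have hiL : (hi <= L)%N.
  by rewrite /hi; have := ltn_ord s; have := ltn_ord t; lia.
(* W x y is the parity of the number of crossings of the leftward horizontal ray
   starting slightly above (x, y) with the part of K between the indices of its
   highest and lowest points, prolonged upwards to infinity at its highest
   point.  Within the strip it is locally constant off K. *)
pose W x y := ((y == (K t).2) && ((K t).1 < x)) (+)
  \big[addb/false]_(lo <= i < hi) edge_left (K i) (K i.+1) x y.
have Wh x y : (forall i, (i <= L)%N -> K i != (x, y)) -> W (x + 1) y = W x y.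
  move=> nK; rewrite /W; congr (_ (+) _).
    have := nK t (ltn_ord t); case: (K t) => c d /=; rewrite xpair_eqE => n.
    by apply/andP/andP => -[]; lia.
  apply: eq_big_nat => i /andP[_ ihi].
  by apply: edge_left_horizontal; [apply: wK | apply: nK | apply: nK]; lia.
have Wv x y : (forall i, (i <= L)%N -> K i != (x, y + 1)) ->
    (K s).2 <= y -> y + 1 <= (K t).2 -> W x (y + 1) = W x y.
  move=> nK sy yt.
  suff: W x (y + 1) (+) W x y = false by case: (W _ _); case: (W _ _).
  rewrite /W addbACA -big_split /=.
  under eq_big_nat => i /andP[_ ihi].
    rewrite edge_left_vertical;
      [|by apply: wK; lia|by apply: nK; lia|by apply: nK; lia].
    over.
  (* Only the indices [lo] and [hi] remain. The lowest point is below height [y + 1]; the term of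
     the highest point cancels with the prolongation. *)
  rewrite (addb_telescope (fun i => ((K i).1 < x) && ((K i).2 == y + 1)) lohi).
  have -> : ((K lo).1 < x) && ((K lo).2 == y + 1) (+)
    ((K hi).1 < x) && ((K hi).2 == y + 1) = ((K t).1 < x) && ((K t).2 == y + 1).
    have sF : ((K s).2 == y + 1) = false by lia.
    rewrite /lo /hi; case: (leqP s t) => st; rewrite sF andbF ?addbF //.
  have -> : (y == (K t).2) = false by lia.
  by rewrite addbF andbC [y + 1 == _]eq_sym addbb.
have Wadj z z' : neighbor z z' -> (forall i, (i <= L)%N -> K i != z) ->
    (forall i, (i <= L)%N -> K i != z') -> (K s).2 <= z.2 <= (K t).2 ->
    (K s).2 <= z'.2 <= (K t).2 -> W z.1 z.2 = W z'.1 z'.2.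
  case: z z' => [x y] [x' y'] /neighborP /= zz' nz nz'
    /andP[sz zt] /andP[sz' zt'].
  case: zz' => [[xx [yy|[yy|yy]]]|[yy [xx|xx]]]; subst=> //.
  - by rewrite Wv.
  - by rewrite Wv.
  - by rewrite Wh.
  - by rewrite Wh.
(* No edge of [K] rises above its top height, so only the prolongation counts there. *)
have Wtop x : W x (K t).2 = ((K t).1 < x).
  rewrite /W eqxx /= big_nat big1 ?addbF // => i /andP[_ ihi].
  have h1 : (K i).2 <= (K t).2 by apply: tmax; lia.
  have h2 : (K i.+1).2 <= (K t).2 by apply: tmax; lia.
  rewrite /edge_left; apply/negP => /andP[_]; lia.
have Wconst c : (forall i j, (i <= L)%N -> (j <= L)%N -> K i != K j + (c, 0)) ->
    forall j, (j <= L)%N ->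
    W ((K j).1 + c) (K j).2 = W ((K 0%N).1 + c) (K 0%N).2.
  move=> nc; elim=> [//|j IH jL]; rewrite -IH; last by lia.
  have e i : (K i + (c, 0)) = ((K i).1 + c, (K i).2).
    by case: (K i) => u v; congr pair; rewrite /= ?addr0.
  symmetry; apply: (Wadj ((K j).1 + c, (K j).2) ((K j.+1).1 + c, (K j.+1).2)).
  - by move: (wK j jL); rewrite /neighbor /=; lia.
  - by move=> i iL; rewrite -e; apply: nc => //; lia.
  - by move=> i iL; rewrite -e; apply: nc.
  - by rewrite /= tmax ?smin //; lia.
  - by rewrite /= tmax ?smin.
have nb' i j : (i <= L)%N -> (j <= L)%N -> K i != K j + (- b, 0).
  move=> iL jL; apply: contra_neq (nb j i jL iL) => ->.
  by case: (K j) => u v; congr pair; rewrite /= ?addr0 // subrK.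
(* [W] is true along [K + (a, 0)], which passes to the right of the top point, and false along
   [K - (b, 0)], which passes to its left; yet both contain [K 0 + (a, 0) = K L - (b, 0)]. *)
have := Wconst _ na t (ltn_ord t); rewrite Wtop ltrDl a0 => /esym h1.
have := Wconst _ nb' t (ltn_ord t); rewrite Wtop.
have := Wconst _ nb' L (leqnn L).
have [-> ->] : (K L).1 = (K 0%N).1 + a + b /\ (K L).2 = (K 0%N).2.
  by rewrite KL; case: (K 0%N) => u v; rewrite /= addrA addr0.
rewrite addrK h1 => <-; lia.
Qed.

(** * Chains of lattice points inside a set *)

Lemma pair_mulrn (V W : nmodType) (x : V) (y : W) n :
  (x, y) *+ n = (x *+ n, y *+ n).
Proof. by elim: n => [//|n IH]; rewrite !mulrS IH. Qed.

Definition chain (V : set (int * int)) (z z' : int * int) : Prop :=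
  exists K L, [/\ walk K L, K 0%N = z, K L = z' &
                  forall i, (i <= L)%N -> V (K i)].

Lemma chain_sym V z z' : chain V z z' -> chain V z' z.
Proof.
case=> K [L [wK K0 KL VK]]; exists (fun i => K (L - i)%N), L.
split=> [i iL| | |i iL]; rewrite ?subn0 ?subnn //; last by apply: VK; lia.
have := wK (L - i.+1)%N; rewrite subnSK // /neighbor => /(_ ltac:(lia)).
by rewrite distrC [X in _ + X]distrC; apply.
Qed.

Lemma chain_trans V z1 z2 z3 : chain V z1 z2 -> chain V z2 z3 -> chain V z1 z3.
Proof.
case=> K [L [wK K0 KL VK]] [K' [L' [wK' K0' KL' VK']]].
exists (fun i => if (i <= L)%N then K i else K' (i - L)%N), (L + L')%N.
split=> [i iL| | |i iL] //.
- case: ltngtP => iL0.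
  + by apply: wK.
  + by rewrite subSn; [apply: wK'; lia|lia].
  + by rewrite iL0 KL -K0' subSnn; apply: wK'; lia.
- case: ltngtP => h; [lia| by rewrite addKn |].
  by rewrite h KL -K0' -KL'; congr K'; lia.
- case: leqP => h; [exact: VK | apply: VK'; lia].
Qed.

Lemma chain_segment V z z' (d : int * int) (k : nat) : neighbor 0 d ->
  z' = z + d *+ k -> (forall i, (i <= k)%N -> V (z + d *+ i)) -> chain V z z'.
Proof.
move=> d1 -> Vz; exists (fun i => z + d *+ i), k; split=> // [i ik|].
  rewrite mulrS; move: (d *+ i) d1; case: z d {Vz} => [u v] [d1 d2] [w1 w2].
  by rewrite /neighbor /=; lia.
by rewrite mulr0n addr0.
Qed.

(** With [x <= x'] after a possible reversal, the chain runs horizontally to [(x', y)] and then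
    vertically. *)
Lemma chain_box V x y x' y' : (forall i j, Num.min x x' <= i <= Num.max x x' ->
    Num.min y y' <= j <= Num.max y y' -> V (i, j)) -> chain V (x, y) (x', y').
Proof.
wlog xx : x x' y y' / x <= x' => [hw|] Vb.
  case: (leP x x') => h; first exact: hw.
  apply/chain_sym/hw; first exact: ltW.
  by move=> i j ix jy; apply: Vb; rewrite ?[Num.min x _]minC ?[Num.max x _]maxC
    ?[Num.min y _]minC ?[Num.max y _]maxC.
apply: (@chain_trans _ _ (x', y)).
  apply: (@chain_segment _ _ _ (1, 0) `|x' - x|%N) => //.
    by rewrite pair_mulrn; congr pair => /=; lia.
  by move=> i ik; rewrite pair_mulrn; apply: Vb => /=; lia.
wlog yy : y y' Vb / y <= y' => [hw|].
  case: (leP y y') => h; first exact: hw.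
  apply/chain_sym/hw; last exact: ltW.
  by move=> i j ix jy; apply: Vb; rewrite // minC maxC.
apply: (@chain_segment _ _ _ (0, 1) `|y' - y|%N) => //.
  by rewrite pair_mulrn; congr pair => /=; lia.
by move=> i ik; rewrite pair_mulrn; apply: Vb => /=; lia.
Qed.

(** * Connected open sets seen on a fine mesh *)

Section mesh.
Variable R : realType.
Implicit Types (U : set (plane R)) (m : nat).

(** With step [1 / m], a horizontal translation by an integer [k] is the lattice translation by
    [m * k]. *)
Definition mesh_point m (z : int * int) : plane R :=
  (z.1%:~R / m%:R, z.2%:~R / m%:R).

Definition mesh_floor m (x : plane R) : int * int :=
  (Num.floor (m%:R * x.1), Num.floor (m%:R * x.2)).

(** Rounding down moves a coordinate by less than [1 / m < r / 2], which fits in the margin between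
    [r / 2] and [r]. *)
Lemma floor_mesh m (a a' c r : R) (i : int) : (0 < m)%N -> 2 < m%:R * r ->
  `|c - a| < r / 2 -> `|c - a'| < r / 2 ->
  Num.min (Num.floor (m%:R * a)) (Num.floor (m%:R * a')) <= i <=
  Num.max (Num.floor (m%:R * a)) (Num.floor (m%:R * a')) ->
  `|c - i%:~R / m%:R| < r.
Proof.
move=> m0 mr ca ca' /andP[].
have m0' : 0 < m%:R :> R by rewrite ltr0n.
have /andP[la ua] := floor_itv (m%:R * a).
have /andP[la' ua'] := floor_itv (m%:R * a').
move: la ua la' ua'; rewrite !intrD.
set f := Num.floor _; set f' := Num.floor _ => la ua la' ua' imin imax.
pose t : R := i%:~R / m%:R.
have it : i%:~R = m%:R * t by rewrite /t mulrC divfK // gt_eqF.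
have lt_t b : m%:R * b < i%:~R + 1 -> b - r / 2 < t.
  by move=> h; rewrite -(ltr_pM2l m0'); rewrite it in h; lra.
have le_t b : i%:~R <= m%:R * b -> t <= b by rewrite it ler_pM2l.
have h1 : a - r / 2 < t \/ a' - r / 2 < t.
  have [fi|fi] : f <= i \/ f' <= i by lia.
    by left; apply: lt_t; rewrite -(ler_int R) in fi; lra.
  by right; apply: lt_t; rewrite -(ler_int R) in fi; lra.
have h2 : t <= a \/ t <= a'.
  have [fi|fi] : i <= f \/ i <= f' by lia.
    by left; apply: le_t; rewrite -(ler_int R) in fi; lra.
  by right; apply: le_t; rewrite -(ler_int R) in fi; lra.
rewrite -/t; move: ca ca'; rewrite !ltr_norml => /andP[c1 c2] /andP[c3 c4].
by apply/andP; split; lra.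
Qed.

Lemma locally_chain U x : open U -> U x -> exists2 r : R, 0 < r &
  forall y, ball x r y -> exists N, forall m, (N <= m)%N ->
    chain [set z | U (mesh_point m z)] (mesh_floor m x) (mesh_floor m y).
Proof.
move=> oU Ux; have /nbhs_ballP[r /= r0 rU] := open_nbhs_nbhs (conj oU Ux).
(* Balls are squares here: the one of radius [r] contains the whole lattice box between the
   roundings of [x] and [y] once [m > 2 / r]. *)
exists (r / 2); first by rewrite divr_gt0.
move=> y [xy1 xy2]; exists (Num.truncn (2 / r)).+1 => m Nm.
have m0 : (0 < m)%N by lia.
have mr : 2 < m%:R * r.
  rewrite -ltr_pdivrMr //; apply: lt_le_trans (truncnS_gt _) _.
  by rewrite ler_nat.
have xx (c : R) : `|c - c| < r / 2 by rewrite subrr normr0 divr_gt0.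
apply: chain_box => i j hi hj; apply: rU; split.
  by apply: (floor_mesh m0 mr _ _ hi).
by apply: (floor_mesh m0 mr _ _ hj).
Qed.

(** The points of [U] joined to [p] on all fine enough meshes form a nonempty subset that is open
    and closed in [U]. *)
Lemma eventually_chain U : open U -> connected U -> forall p q, U p -> U q ->
  exists N, forall m, (N <= m)%N ->
    chain [set z | U (mesh_point m z)] (mesh_floor m p) (mesh_floor m q).
Proof.
move=> oU cU p q Up Uq.
pose S x := exists N, forall m, (N <= m)%N ->
    chain [set z | U (mesh_point m z)] (mesh_floor m p) (mesh_floor m x).
have near x : U x -> \forall y \near x, U y /\ (S x <-> S y).
  move=> Ux; have [r r0 hr] := locally_chain oU Ux.
  apply: filterI; first exact: open_nbhs_nbhs.
  apply/nbhs_ballP; exists r => //= y /hr[N hN]; split=> -[M hM];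
    exists (maxn M N) => m; rewrite geq_max => /andP[Mm Nm];
    apply: chain_trans (hM m Mm) _; last apply: chain_sym; exact: hN.
suff e : U `&` S = U by have [] : (U `&` S) q by rewrite e.
apply: cU.
- exists p; split=> //; have [r r0 hr] := locally_chain oU Up.
  exact/hr/ballxx.
- exists (U `&` S); last by rewrite setIA setIid.
  rewrite openE => x [Ux Sx]; apply: filterS (near x Ux) => y [Uy xy].
  by split=> //; apply/xy.
- exists (~` (U `\` S)).
    apply: open_closedC; rewrite openE => x [Ux Sx].
    by apply: filterS (near x Ux) => y [Uy xy]; split=> // /xy.
  apply/seteqP; split=> x [Ux Sx]; split=> //; first by case.
  by apply: contrapT => nS; apply: Sx.
Qed.

Lemma no_multiple_horizontal_chord U : open U -> connected U ->
  (forall x y, U (x, y) -> ~ U (x + 1, y)) ->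
  forall n x y, U (x, y) -> ~ U (x + n.+1%:R, y).
Proof.
move=> oU cU U1; elim=> [//|n IH] x y Up Uq.
have [N hN] := eventually_chain oU cU Up Uq.
have {hN} := hN N.+1 (leqnSn N); set m := N.+1.
have m0 : m%:R != 0 :> R by rewrite pnatr_eq0.
have shift z (k : nat) : mesh_point m (z + ((m * k)%:Z, 0)) =
    ((mesh_point m z).1 + k%:R, (mesh_point m z).2).
  by case: z => u v; rewrite /mesh_point /= addr0 intrD mulrDl -pmulrn natrM
    [m%:R * _]mulrC mulfK.
case=> K [L [wK K0 KL UK]].
(* The chord [n.+2] splits as [1 + n.+1], excluded by [U1] and by induction. *)
apply: (@no_chord_sum K L (m * 1)%N%:Z (m * n.+1)%N%:Z) => //.
- rewrite KL K0 /mesh_floor /=; congr pair; last by rewrite /= addr0.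
  have -> : m%:R * (x + n.+1.+1%:R) = m%:R * x + (m * n.+2)%N%:Z%:~R :> R.
    by rewrite mulrDr -natrM.
  rewrite floorDrz ?intr_int // intrKfloor.
  by rewrite -PoszD -mulnDr.
- move=> i j iL jL; apply/eqP => e; have := UK i iL; rewrite /= e shift.
  by apply: U1; apply: UK.
- move=> i j iL jL; apply/eqP => e; have := UK i iL; rewrite /= e shift.
  by apply: IH; apply: UK.
Qed.

(** * Chords in an arbitrary direction *)

Lemma continuous_pair (T U V : topologicalType) (f : T -> U) (g : T -> V) :
  continuous f -> continuous g -> continuous (fun x => (f x, g x)).
Proof. by move=> cf cg x; exact: cvg_pair (cf x) (cg x). Qed.

Lemma no_multiple_chord U (v : plane R) : open U -> connected U -> v != 0 ->
  (forall z, U z -> ~ U (z + v)) -> forall n z, U z -> ~ U (z + v *+ n.+1).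
Proof.
case: v => a b oU cU v0 U1 n p Up.
have d0 : a ^+ 2 + b ^+ 2 != 0.
  apply: contra v0; rewrite paddr_eq0 ?sqr_ge0 // !sqrf_eq0.
  by move=> /andP[/eqP -> /eqP ->].
pose d := a ^+ 2 + b ^+ 2.
(* [f] is complex multiplication by [a + ib] and [g] is its inverse; [f] carries [(1, 0)] to
   [(a, b)]. *)
pose f (z : plane R) : plane R := (z.1 * a - z.2 * b, z.1 * b + z.2 * a).
pose g (z : plane R) : plane R :=
  ((z.1 * a + z.2 * b) / d, (z.2 * a - z.1 * b) / d).
have fK : cancel f g.
  by move=> [x y]; rewrite /f /g /d /=; congr pair; field.
have gK : cancel g f.
  by move=> [x y]; rewrite /f /g /d /=; congr pair; field.
have c1 : continuous (fun z : plane R => z.1) by move=> z; exact: cvg_fst.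
have c2 : continuous (fun z : plane R => z.2) by move=> z; exact: cvg_snd.
have cM (h : plane R -> R) c : continuous h -> continuous (fun z => h z * c).
  by move=> ch z; apply: cvgM; [exact: ch|exact: cvg_cst].
have cf : continuous f.
  by apply: continuous_pair => z; [apply: cvgB|apply: cvgD]; apply: cM.
have cg : continuous g.
  by apply: continuous_pair; apply: (cM) => z;
    [apply: cvgD|apply: cvgB]; apply: cM.
have gU : g @` U = f @^-1` U.
  by apply/seteqP; split=> [_ [z Uz <-]|z Uz]; [rewrite /= gK|exists (f z)].
have oV : open (f @^-1` U) by apply: open_comp => // z _; exact: cf.
have cV : connected (f @^-1` U).
  rewrite -gU; apply: connected_continuous_connected => //.
  exact: continuous_subspaceT.
have fD x y k : f (x + k%:R, y) = f (x, y) + (a, b) *+ k.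
  by rewrite pair_mulrn /f /=; congr pair => /=; rewrite -mulr_natr; ring.
have main : U (f ((g p).1, (g p).2)) -> ~ U (f ((g p).1 + n.+1%:R, (g p).2)).
  apply: (no_multiple_horizontal_chord oV cV) => x y.
  by rewrite /preimage /mkset (fD x y 1%N) mulr1n; exact: U1.
by rewrite fD -surjective_pairing gK in main; exact: main.
Qed.
End mesh.

(** * Invariance of overlaps and bonds under translation *)

Section tiles.
Variable R : realType.
Implicit Types (A B : set (plane R)) (P : tile R) (u v w : plane R).

Lemma translateE v A : translate v A = (fun x => x - v) @^-1` A.
Proof.
apply/seteqP; split=> [_ [x Ax <-]|x Ax]; first by rewrite /= addrC addKr.
by exists (x - v) => //; rewrite addrC subrK.
Qed.

Lemma translateD u v A : translate (u + v) A = translate u (translate v A).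
Proof.
by rewrite !translateE; apply/seteqP; split=> x /=; rewrite opprD addrA.
Qed.

Lemma continuous_addr v : continuous (fun x : plane R => x + v).
Proof.
move: v => [a b]; apply: continuous_pair => x;
  by apply: cvgD; [exact: cvg_fst || exact: cvg_snd | exact: cvg_cst].
Qed.

Lemma translate_interior v A : (translate v A)° = translate v A°.
Proof.
have sub w B : translate w B° `<=` (translate w B)°.
  by rewrite !translateE => x; exact: (@continuous_addr (- w)).
apply/seteqP; split; last exact: sub.
have t0 B : translate 0 B = B.
  by rewrite translateE; apply/seteqP; split=> x /=; rewrite subr0.
(* The converse is [sub] for [- v], translated back by [v]. *)
rewrite -{2}[A]t0 -(addNr v) translateD -[X in X `<=` _]t0 -{1}(addrN v).
by rewrite translateD; apply: image_subset; exact: sub.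
Qed.

Lemma translateI v A B :
  translate v (A `&` B) = translate v A `&` translate v B.
Proof. by rewrite !translateE. Qed.

Lemma translate_nonempty v A : translate v A !=set0 <-> A !=set0.
Proof. by split=> [[_ [x Ax _]]|[x Ax]]; [exists x|exists (v + x), x]. Qed.

Lemma overlap_translate w A B :
  overlap (translate w A) (translate w B) <-> overlap A B.
Proof.
by rewrite /overlap !translate_interior -translateI translate_nonempty.
Qed.

Lemma touch_translate w A B :
  touch (translate w A) (translate w B) <-> touch A B.
Proof. by rewrite /touch -translateI translate_nonempty overlap_translate. Qed.

Lemma more_than_one_point_translate w A :
  more_than_one_point (translate w A) <-> more_than_one_point A.
Proof.
split=> [[_ [_ [[x Ax <-] [y Ay <-] n]]]|[x [y [Ax Ay n]]]].
  by exists x, y; split=> // e; apply: n; rewrite e.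
by exists (w + x), (w + y); split; [exists x|exists y|move/addrI].
Qed.

Lemma bond_strength_translate P w u v :
  bond_strength P (w + u) (w + v) = bond_strength P u v.
Proof.
rewrite /bond_strength; congr esum.
apply/funext => ij; rewrite /bonds /copy /mkset !translateD -translateI.
by rewrite (propext (touch_translate _ _ _))
  (propext (more_than_one_point_translate _ _)).
Qed.

Lemma bond_strength_ge0 P u v : (0 <= bond_strength P u v)%E.
Proof. by apply: esum_ge0 => ij _; rewrite lee_fin. Qed.

(** The copies at [0] and [w] overlap exactly when the interior of the shape has two points
    differing by [w]. *)
Lemma overlap_multiple P v n : v != 0 -> ~ overlap (copy P 0) (copy P v) ->
  ~ overlap (copy P 0) (copy P (v *+ n.+1)).
Proof.
have overlapE w : overlap (copy P 0) (copy P w) <->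
    exists2 z, (Defs.shape P)° z & (Defs.shape P)° (z + w).
  rewrite /overlap /copy !translate_interior !translateE; split=> -[x].
    by move=> [/= h1 h2]; exists (x - w) => //; rewrite subrK -[x]subr0.
  by move=> h1 h2; exists (x + w); split; rewrite /= ?subr0 ?addrK.
move=> v0; rewrite !overlapE => n1 [z Uz]; apply: no_multiple_chord => //.
- exact: open_interior.
- exact: shape_interior_connected.
- by move=> x Ux Uxv; apply: n1; exists x.
Qed.

(** * Rows of equally spaced copies *)

Definition tile_row v (n : nat) : {fset plane R} :=
  iteri n (fun i F => (v *+ i.+1 |` F)%fset) [fset 0]%fset.

Lemma mem_tile_row v n u :
  (u \in tile_row v n) <-> exists2 i, (i <= n)%N & u = v *+ i.
Proof.
elim: n => [|n IH]; rewrite /tile_row ?iteriS /= ?in_fset1U.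
  rewrite in_fset1; split=> [/eqP ->|[[]// _ ->]]; last exact: eqxx.
  by exists 0%N.
split=> [/orP[/eqP ->|/IH[i ni ->]]|[i]]; first by exists n.+1.
  by exists i => //; lia.
rewrite leq_eqVlt => /orP[/eqP -> -> |]; first by rewrite eqxx.
by rewrite ltnS => ni ui; apply/orP; right; apply/IH; exists i.
Qed.

Lemma mulrn_injl v (i j : nat) : v != 0 -> v *+ i = v *+ j -> i = j.
Proof.
have inj (c : R) : c != 0 -> c *+ i = c *+ j -> i = j.
  move=> c0; rewrite -!(mulr_natr c) => /(mulfI c0)/eqP.
  by rewrite eqr_nat => /eqP.
case: v => a b; rewrite !pair_mulrn xpair_eqE negb_and.
by case/orP=> c0 [ea eb]; [exact: inj ea|exact: inj eb].
Qed.

Lemma card_tile_row v n : v != 0 -> #|` tile_row v n| = n.+1.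
Proof.
move=> v0; elim: n => [|n IH]; first exact: cardfs1.
rewrite /tile_row iteriS cardfsU1 IH.
case: (boolP (_ \in _)) => // /mem_tile_row[i ni /(mulrn_injl v0)]; lia.
Qed.

Lemma producible_tile_row P tau v n :
  v != 0 -> ~ overlap (copy P 0) (copy P v) ->
  ((tau%:R)%:E <= bond_strength P 0%R v)%E -> producible P tau (tile_row v n).
Proof.
move=> v0 nov tv; elim: n => [|n IH]; first exact: producible_seed.
apply: producible_add => // [u /mem_tile_row[i ni ->]|].
  have -> : v *+ n.+1 = v *+ i + v *+ (n - i).+1.
    by rewrite -mulrnDr; congr (_ *+ _); lia.
  rewrite -[X in copy P X]addr0 /copy !translateD overlap_translate.
  exact: overlap_multiple.
(* The bond with the predecessor suffices; the other terms are nonnegative. *)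
have vn : v *+ n \in tile_row v n by apply/mem_tile_row; exists n.
rewrite (big_rem _ vn) /= mulrS -[X in bond_strength P X]addr0 [v + _]addrC.
rewrite bond_strength_translate.
apply: (le_trans tv); rewrite leeDl // sume_ge0 // => u _.
exact: bond_strength_ge0.
Qed.
End tiles.

Theorem theorem4 (R : realType) (P : tile R) (tau : nat) :
  (forall A : {fset plane R},
     producible P tau A <-> A = [fset (0 : plane R)]%fset) \/
  (forall n : nat, exists A : {fset plane R},
     producible P tau A /\ (n <= #|` A|)%N).
Proof.
have [[v [v0 nov tv]]|nv] := pselect (exists v : plane R, [/\ v != 0,
  ~ overlap (copy P 0) (copy P v) & ((tau%:R)%:E <= bond_strength P 0%R v)%E]).
  right=> n; exists (tile_row v n); split; first exact: producible_tile_row.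
  by rewrite card_tile_row.
left=> A; split=> [|->]; last exact: producible_seed.
elim=> [//|{}A v _ -> nov tv].
(* For an empty shape, overlap does not rule out a second copy at [0]; inserting it leaves the set
   unchanged. *)
have [->|v0] := eqVneq v 0; first by rewrite fsetUid.
case: nv; exists v; split=> //; first by apply: nov; rewrite in_fset1.
by move: tv; rewrite big_seq_fset1.
Qed.
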